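(* Let $(X,\rho_X)$ and $(Y,\rho_Y)$ be compact metric spaces, and let $\rho$ be a metric on the disjoint union $Z=X\,\dot\cup\,Y$ whose restrictions to $X$ and $Y$ are $\rho_X$ and $\rho_Y$, with $\mathrm{dist}_H^{\rho}(X,Y)<\varepsilon$. Let $n$ be a positive integer and let $r\in\mathbb R^+$ with $\varepsilon r<1/2$. Let $\Pi$ be a path component of $\mathcal P_n^r(X)$. Let $s\in\mathbb R^+$ with $s\ge r$ and $\varepsilon s<1/2$. Let $p_0,p_1\in\Pi$ and suppose that there are $q_0$ and $q_1$ in $\mathcal P_n^s(Y)$ with $L(p_j\oplus q_j)\le s$ for $j=0,1$. Assume, moreover, that there is a path $\tilde p$ in $\Pi$ connecting $p_0$ and $p_1$ that lies in $\Phi_X(\mathcal P_n^s(Z))$. Then for any $\delta$ with $2\varepsilon s<\delta<1$ there exist a path $p$ in $\mathcal P_n(X)$ going from $p_0$ to $p_1$ and a path $q$ in $\mathcal P_n(Y)$ going from $q_0$ to $q_1$ such that $$L(p_t\oplus q_t)<(1-\delta)^{-1}s$$ for each $t$. The situation is symmetric between $X$ and $Y$, so the roles of $X$ and $Y$ can be interchanged: with the same $\rho$, $\varepsilon$, $n$, $r$ and $s$, if $\Pi'$ is a path component of $\mathcal P_n^r(Y)$, if $q_0,q_1\in\Pi'$ and $p_0,p_1\in\mathcal P_n^s(X)$ satisfy $L(p_j\oplus q_j)\le s$ for $j=0,1$, and if there is a path $\tilde q$ in $\Pi'$ connecting $q_0$ and $q_1$ that lies in $\Phi_Y(\mathcal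 P_n^s(Z))$, where $\Phi_Y:\mathcal P_n(Z)\to\mathcal P_n(Y)$ is the restriction map, then for any $\delta$ with $2\varepsilon s<\delta<1$ there exist a path $p$ in $\mathcal P_n(X)$ going from $p_0$ to $p_1$ and a path $q$ in $\mathcal P_n(Y)$ going from $q_0$ to $q_1$ such that $L(p_t\oplus q_t)<(1-\delta)^{-1}s$ for each $t$.
   Context: For a compact metric space $(W,\rho)$ let $C(W)$ be the algebra of continuous complex-valued functions. $M_n(C(W))$ is viewed as the algebra of continuous functions from $W$ to $M_n(\mathbb C)$, where $M_n(\mathbb C)$ carries the operator norm for its action on $\mathbb C^n$, with norm $\|a\|=\sup_{w}\|a(w)\|$ and pointwise adjoint. For $a\in M_n(C(W))$, $L(a)=\sup\{\|a(x)-a(y)\|/\rho(x,y): x\ne y\}\in[0,\infty]$. A projection is an element $p$ with $p=p^2=p^*$. $\mathcal P_n(W)$ is the set of projections $p\in M_n(C(W))$ with $L(p)<\infty$, and for $r\in\mathbb R^+$, $\mathcal P_n^r(W)=\{p\in\mathcal P_n(W): L(p)<r\}$. For $Z=X\,\dot\cup\,Y$, $p\oplus q$ denotes the function on $Z$ equal to $p$ on $X$ and $q$ on $Y$, and $L(p\oplus q)$ is computed with $\rho$. $\Phi_X:\mathcal P_n(Z)\to\mathcal P_n(X)$ is the restriction map. $\mathrm{dist}_H^\rho(X,Y)$ is the Hausdorff distance between $X$ and $Y$ in $(Z,\rho)$. A path is a norm-continuous function with domain $[0,1]$, and path components are taken for the norm topology. *)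

(* Defs.v *)
From HB Require Import structures.
From mathcomp Require Import all_boot all_order all_algebra.
From mathcomp Require Import sesquilinear spectral complex.
From mathcomp Require Import all_classical all_reals all_analysis.

Set Implicit Arguments.
Unset Strict Implicit.
Unset Printing Implicit Defensive.

Import Order.TTheory GRing.Theory Num.Theory.
Import numFieldNormedType.Exports.

Local Open Scope classical_set_scope.
Local Open Scope ring_scope.
Local Open Scope sesquilinear_scope.

Definition is_metric (R : realType) (T : Type) (d : T -> T -> R) : Prop :=
  [/\ forall x, d x x = 0,
      forall x y, d x y = 0 -> x = y,
      forall x y, d x y = d y x &
      forall y x z, d x z <= d x y + d y z].

Definition with_metric (R : realType) (T : choiceType) (d : T -> T -> R)
  (hd : is_metric d) : Type := T.

Section with_metric.
Context (R : realType) (T : choiceType) (d : T -> T -> R) (hd : is_metric d).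

Let dxx x : d x x = 0. Proof. by case: hd. Qed.
Let dpos x y : d x y = 0 -> x = y. Proof. by case: hd => _ + _ _; exact. Qed.
Let dC x y : d x y = d y x. Proof. by case: hd. Qed.
Let dtri y x z : d x z <= d x y + d y z. Proof. by case: hd. Qed.

HB.instance Definition _ := Choice.on (with_metric hd).
HB.instance Definition _ :=
  @isMetric.Build R (with_metric hd) d dxx dpos dC dtri.

End with_metric.

(* Extended-real valued, so that the distance from a point to the empty set
   is [+oo]. *)
Definition dist_to (R : realType) (Z : metricType R) (A : set Z) (z : Z)
  : \bar R :=
  ereal_inf [set (mdist z a)%:E | a in A].

Definition hausdorff_dist (R : realType) (Z : metricType R) (A B : set Z)
  : \bar R :=
  maxe (ereal_sup [set dist_to B a | a in A])
       (ereal_sup [set dist_to A b | b in B]).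

Definition l2norm (R : realType) (n : nat) (v : 'cV[R[i]]_n) : R :=
  Num.sqrt (\sum_(k < n) (ComplexField.Normc.normc (v k 0)) ^+ 2).

Definition opnorm (R : realType) (n : nat) (A : 'M[R[i]]_n) : R :=
  sup [set l2norm (A *m v) | v in [set v : 'cV[R[i]]_n | l2norm v <= 1]].

Section matrix_functions.
Context (R : realType) (n : nat) (W : metricType R).
Implicit Type a : W -> 'M[R[i]]_n.

Definition mx_continuous a : Prop :=
  forall w, opnorm (a v - a w) @[v --> w] --> (0 : R).

(* Only meaningful for bounded [a], e.g. continuous [a] on compact [W]:
   [sup] of an unbounded set of reals is [0]. *)
Definition mx_norm_sup a : R := sup [set opnorm (a w) | w in [set: W]].

(* The [maxe 0] makes the supremum of the empty family (when [W] has at most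
   one point) equal to [0], as in [0, +oo]. *)
Definition lipL a : \bar R :=
  maxe 0%E (ereal_sup
    [set (opnorm (a u.1 - a u.2) / mdist u.1 u.2)%:E
       | u in [set u : W * W | u.1 <> u.2]]).

Definition is_projection a : Prop :=
  forall w, a w *m a w = a w /\ (a w) ^t* = a w.

Definition lip_proj : set (W -> 'M[R[i]]_n) :=
  [set a | [/\ mx_continuous a, is_projection a & (lipL a < +oo)%E]].

Definition lip_proj_lt (r : R) : set (W -> 'M[R[i]]_n) :=
  [set a | lip_proj a /\ (lipL a < r%:E)%E].

(* Only the values of [g] on [0, 1] matter. *)
Definition is_path (S : set (W -> 'M[R[i]]_n)) (g : R -> W -> 'M[R[i]]_n)
    (a b : W -> 'M[R[i]]_n) : Prop :=
  [/\ forall t : R, t \in `[0, 1] -> S (g t),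
      forall t : R, t \in `[0, 1] ->
        mx_norm_sup (g u - g t) @[u --> within `[0, 1] (nbhs t)] --> (0 : R),
      g 0 = a & g 1 = b].

Definition is_path_component (S C : set (W -> 'M[R[i]]_n)) : Prop :=
  exists2 a, S a & C = [set b | exists g, is_path S g a b].

End matrix_functions.

Arguments lip_proj {R} n W.
Arguments lip_proj_lt {R} n W r.

Section direct_sum.
Context (R : realType) (n : nat) (X Y : metricType R).
Context (rho : X + Y -> X + Y -> R) (hrho : is_metric rho).
Notation Z := (with_metric hrho).

Definition oplus (p : X -> 'M[R[i]]_n) (q : Y -> 'M[R[i]]_n)
  : Z -> 'M[R[i]]_n :=
  fun z => match z with inl x => p x | inr y => q y end.

Definition restrX (a : Z -> 'M[R[i]]_n) : X -> 'M[R[i]]_n := fun x => a (inl x).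

Definition restrY (a : Z -> 'M[R[i]]_n) : Y -> 'M[R[i]]_n := fun y => a (inr y).

Definition partX : set Z := [set z | exists x : X, z = inl x].

Definition partY : set Z := [set z | exists y : Y, z = inr y].

End direct_sum.

Arguments oplus {R n X Y rho} hrho p q _.
Arguments restrX {R n X Y rho} hrho a _.
Arguments restrY {R n X Y rho} hrho a _.
Arguments partX {R X Y rho} hrho _.
Arguments partY {R X Y rho} hrho _.

(* Main.v *)
Require Import Defs.
From mathcomp Require Import all_boot all_order all_algebra complex.
From mathcomp Require Import sesquilinear spectral ring lra.
From mathcomp Require Import all_classical all_reals all_analysis.

Import Order.TTheory GRing.Theory Num.Theory.
Import numFieldNormedType.Exports.

Local Open Scope classical_set_scope.
Local Open Scope ring_scope.
Local Open Scope sesquilinear_scope.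
Local Open Scope complex_scope.

Set Implicit Arguments.
Unset Strict Implicit.
Unset Printing Implicit Defensive.

(** The two paths are built together, as one path of projections over the
    whole space Z.

    Step from one projection to a close one.  Let P and Q be projections over
    Z with Lipschitz constant s and P - Q of norm at most d < 1 at each point.
    The segment a_t = (1 - t) P + t Q is self-adjoint, has Lipschitz constant
    s, and lies within d / 2 of a projection, namely P in the first half and Q
    in the second one.  Its spectrum therefore avoids the interval between
    d / 2 and 1 - d / 2, and the spectral projection E_t of a_t for the upper
    part of the spectrum commutes with a_t and satisfies |a_t - E_t| <= d / 2
    ([spectral_projection_exists]).  A Davis-Kahan estimate ([orthoproj_gap])
    bounds the distance between two such projections by (1 - d)^-1 times the
    distance between the two matrices they come from.  Applied to two points
    of Z at the same time t, it gives the Lipschitz constant (1 - d)^-1 s of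
    E_t; applied to two times at the same point, the continuity of t |-> E_t;
    and with equal matrices, the uniqueness of the projection, hence E_0 = P
    and E_1 = Q ([joinable_close]).

    Following the given path.  Say that it runs over X.  Each projection g_t
    on it extends to a projection h_t over Z with Lipschitz constant s, where
    h_0 and h_1 are the prescribed direct sums.  Nothing makes h_t continuous
    in t away from X, but a point of Z has a point x of X within eps of it, so
    that |h_t - h_u| <= 2 eps s + |g_t - g_u| everywhere.  As 2 eps s < delta,
    for u close to t the right-hand side is at most some d < delta, and the
    first step joins h_t to h_u.  Since being joined by a path with a given
    Lipschitz constant is symmetric and transitive, compactness of the unit
    interval joins h_0 to h_1 ([family_joinable]).  Restriction to X and to Y
    gives the two paths, and d < delta makes the final inequality strict.  The
    case of a path over Y differs only by the subset of Z that is used. *)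

(** * Euclidean norm and operator norm *)

Section euclidean_norm.
Context (R : realType) (n : nat).
Implicit Types (u v w x : 'cV[R[i]]_n) (A B : 'M[R[i]]_n).
Notation normc := ComplexField.Normc.normc.

Lemma normc_ge0 (z : R[i]) : 0 <= normc z.
Proof. by case: z => a b /=; exact: sqrtr_ge0. Qed.

Lemma l2norm_ge0 v : 0 <= l2norm v.
Proof. exact: sqrtr_ge0. Qed.

Lemma sqr_l2norm v : l2norm v ^+ 2 = \sum_(k < n) normc (v k 0) ^+ 2.
Proof. by rewrite sqr_sqrtr // sumr_ge0 // => k _; exact: sqr_ge0. Qed.

Lemma l2norm0 : l2norm (0 : 'cV[R[i]]_n) = 0.
Proof.
rewrite /l2norm big1 ?sqrtr0 // => k _; rewrite mxE.
by rewrite ComplexField.Normc.normc0 expr0n.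
Qed.

Lemma l2norm0_eq0 v : l2norm v = 0 -> v = 0.
Proof.
move=> v0; apply/colP => k; rewrite mxE; apply: ComplexField.Normc.eq0_normc.
have := sqr_l2norm v; rewrite v0 expr0n /= => /esym/eqP.
rewrite psumr_eq0; last by move=> j _; exact: sqr_ge0.
by move=> /allP/(_ k (mem_index_enum _)); rewrite /= sqrf_eq0 => /eqP.
Qed.

Lemma l2normZ (c : R[i]) v : l2norm (c *: v) = normc c * l2norm v.
Proof.
rewrite /l2norm; under eq_bigr do rewrite mxE ComplexField.Normc.normcM exprMn.
by rewrite -mulr_sumr sqrtrM ?sqr_ge0 // sqrtr_sqr ger0_norm // normc_ge0.
Qed.

Lemma l2normN v : l2norm (- v) = l2norm v.
Proof.
by congr Num.sqrt; apply: eq_bigr => k _; rewrite mxE normcN.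
Qed.

(** With a and b the norms of u and v, the coordinatewise inequality
    (x + y)^2 <= (a + b) (x^2 / a + y^2 / b), which is the convexity of the
    square, sums up to the triangle inequality. *)
Lemma l2normD u v : l2norm (u + v) <= l2norm u + l2norm v.
Proof.
have [/l2norm0_eq0 ->|u0] := eqVneq (l2norm u) 0.
  by rewrite add0r l2norm0 add0r.
have [/l2norm0_eq0 ->|v0] := eqVneq (l2norm v) 0.
  by rewrite addr0 l2norm0 addr0.
set a := l2norm u in u0 *; set b := l2norm v in v0 *.
have a0 : 0 < a by rewrite lt_def u0 l2norm_ge0.
have b0 : 0 < b by rewrite lt_def v0 l2norm_ge0.
rewrite -ler_sqr ?nnegrE ?addr_ge0 ?l2norm_ge0 //.
have -> : (a + b) ^+ 2 = (a + b) / a * a ^+ 2 + (a + b) / b * b ^+ 2.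
  by field; rewrite u0 v0.
rewrite (sqr_l2norm u : a ^+ 2 = _) (sqr_l2norm v : b ^+ 2 = _) sqr_l2norm.
rewrite !mulr_sumr -big_split /=; apply: ler_sum => k _; rewrite mxE.
set x := normc (u k 0); set y := normc (v k 0).
apply: (@le_trans _ _ ((x + y) ^+ 2)).
  rewrite ler_sqr ?nnegrE ?addr_ge0 ?normc_ge0 //.
  exact: le_normcD.
rewrite -subr_ge0.
have -> : (a + b) / a * x ^+ 2 + (a + b) / b * y ^+ 2 - (x + y) ^+ 2
    = (b * x - a * y) ^+ 2 / (a * b) by field; rewrite u0 v0.
by rewrite divr_ge0 ?sqr_ge0 // mulr_ge0 // ltW.
Qed.

Lemma l2normB u v : l2norm (u - v) <= l2norm u + l2norm v.
Proof. by rewrite -(l2normN v); exact: l2normD. Qed.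

Lemma l2norm_delta j : l2norm (delta_mx j 0 : 'cV[R[i]]_n) = 1.
Proof.
rewrite /l2norm (bigD1 j) //= mxE !eqxx ComplexField.Normc.normc1 expr1n.
rewrite big1 ?addr0 ?sqrtr1 // => k kj.
by rewrite mxE (negPf kj) ComplexField.Normc.normc0 expr0n.
Qed.

Lemma l2norm_sum (I : Type) (r : seq I) (F : I -> 'cV[R[i]]_n) :
  l2norm (\sum_(k <- r) F k) <= \sum_(k <- r) l2norm (F k).
Proof.
elim/big_ind2: _ => //; first by rewrite l2norm0.
by move=> u a v b ua vb; apply: le_trans (l2normD _ _) _; exact: lerD.
Qed.

Lemma l2norm_dot v : ((l2norm v) ^+ 2)%:C = (v ^t* *m v) 0 0.
Proof.
rewrite sqr_l2norm mxE rmorph_sum /=; apply: eq_bigr => k _.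
by rewrite !mxE mulrC -normCK rmorphXn.
Qed.

Lemma l2norm_pythagoras u v : u ^t* *m v = 0 ->
  l2norm (u + v) ^+ 2 = l2norm u ^+ 2 + l2norm v ^+ 2.
Proof.
move=> uv; have vu : v ^t* *m u = 0.
  have := congr1 (fun M : 'M[R[i]]_1 => M ^t* ) uv.
  by rewrite trmx_mul map_mxM trmxCK trmx0 map_mx0.
apply: complexI; rewrite rmorphD [RHS]/= !l2norm_dot.
have -> : (u + v) ^t* = u ^t* + v ^t* by apply/rowP => k; rewrite !mxE rmorphD.
by rewrite mulmxDl !mulmxDr uv vu addr0 add0r mxE.
Qed.

Lemma l2norm_unitary (U : 'M[R[i]]_n) v : U \is unitarymx ->
  l2norm (U *m v) = l2norm v.
Proof.
move=> Uu; apply/eqP; rewrite -(@eqrXn2 _ 2) ?l2norm_ge0 //; apply/eqP.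
apply: complexI; rewrite !l2norm_dot trmx_mul map_mxM mulmxA.
rewrite -[X in (X *m v)]mulmxA -(invmx_unitary Uu) mulVmx ?mulmx1 //.
exact: unitarymx_unit.
Qed.

End euclidean_norm.

Section operator_norm.
Context (R : realType) (n : nat).
Implicit Types (v x : 'cV[R[i]]_n) (A B : 'M[R[i]]_n).
Notation normc := ComplexField.Normc.normc.

(** The column norms bound the image of the unit ball, so the supremum that
    defines [opnorm] is a genuine one. *)
Lemma opnorm_has_sup A :
  has_sup [set l2norm (A *m v) | v in [set v : 'cV[R[i]]_n | l2norm v <= 1]].
Proof.
split.
  by exists (l2norm (A *m 0)); exists 0 => //=; rewrite l2norm0 ler01.
exists (\sum_(k < n) l2norm (col k A)) => _ [v /= v1 <-].
have -> : A *m v = \sum_(k < n) v k 0 *: col k A.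
  apply/colP => j; rewrite mxE summxE; apply: eq_bigr => k _.
  by rewrite !mxE mulrC.
apply: le_trans (l2norm_sum _ _) _; apply: ler_sum => k _.
rewrite l2normZ ler_piMl ?l2norm_ge0 //; apply: le_trans v1.
rewrite -ler_sqr ?nnegrE ?l2norm_ge0 ?normc_ge0 //.
rewrite sqr_l2norm (bigD1 k) //= lerDl sumr_ge0 // => j _; exact: sqr_ge0.
Qed.

Lemma opnorm_ge0 A : 0 <= opnorm A.
Proof.
apply: (@le_trans _ _ (l2norm (A *m 0))); first exact: l2norm_ge0.
apply: sup_ubound; first by have [] := opnorm_has_sup A.
by exists 0 => //=; rewrite l2norm0 ler01.
Qed.

Lemma l2norm_mulmx A v : l2norm (A *m v) <= opnorm A * l2norm v.
Proof.
have [/l2norm0_eq0 ->|v0] := eqVneq (l2norm v) 0.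
  by rewrite mulmx0 !l2norm0 mulr0.
have vp : 0 < l2norm v by rewrite lt_def v0 l2norm_ge0.
have nV : normc ((l2norm v)^-1)%:C = (l2norm v)^-1.
  by rewrite /= expr0n addr0 sqrtr_sqr ger0_norm // invr_ge0 ltW.
rewrite -ler_pdivrMr //.
have -> : l2norm (A *m v) / l2norm v = l2norm (A *m (((l2norm v)^-1)%:C *: v)).
  by rewrite -scalemxAr l2normZ nV mulrC.
apply: sup_ubound; first by have [] := opnorm_has_sup A.
by exists (((l2norm v)^-1)%:C *: v) => //=; rewrite l2normZ nV mulVf.
Qed.

Lemma opnorm_le A c : 0 <= c -> (forall v, l2norm (A *m v) <= c * l2norm v) ->
  opnorm A <= c.
Proof.
move=> c0 Ac; apply: sup_le_ub; first by have [] := opnorm_has_sup A.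
move=> _ [v /= v1 <-]; apply: le_trans (Ac v) _.
by rewrite ler_piMr.
Qed.

Lemma opnormN A : opnorm (- A) = opnorm A.
Proof.
have le B : opnorm (- B) <= opnorm B.
  apply: opnorm_le (opnorm_ge0 _) _ => v.
  by rewrite mulNmx l2normN l2norm_mulmx.
by apply/eqP; rewrite eq_le le -{1}(opprK A) le.
Qed.

Lemma opnormB A B : opnorm (A - B) = opnorm (B - A).
Proof. by rewrite -opnormN opprB. Qed.

Lemma opnormD A B : opnorm (A + B) <= opnorm A + opnorm B.
Proof.
apply: opnorm_le; first by rewrite addr_ge0 ?opnorm_ge0.
move=> v; rewrite mulmxDl mulrDl; apply: le_trans (l2normD _ _) _.
by rewrite lerD // l2norm_mulmx.
Qed.

Lemma opnorm_dist A B C : opnorm (A - C) <= opnorm (A - B) + opnorm (B - C).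
Proof. by apply: le_trans (opnormD _ _); rewrite addrA subrK. Qed.

Lemma opnormZ (t : R) A : opnorm (t%:C *: A) <= `|t| * opnorm A.
Proof.
apply: opnorm_le; first by rewrite mulr_ge0 ?opnorm_ge0.
move=> v; rewrite -scalemxAl l2normZ /= expr0n addr0 sqrtr_sqr.
by rewrite -mulrA ler_wpM2l // l2norm_mulmx.
Qed.

Lemma opnorm0 : opnorm (0 : 'M[R[i]]_n) = 0.
Proof.
apply/eqP; rewrite eq_le opnorm_ge0 andbT; apply: opnorm_le => // v.
by rewrite mul0mx l2norm0 mul0r.
Qed.

Lemma opnorm_le0_eq0 A : opnorm A <= 0 -> A = 0.
Proof.
move=> A0; apply/matrixP => i j; rewrite mxE.
have /l2norm0_eq0 /colP/(_ i) : l2norm (A *m delta_mx j 0) = 0.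
  apply/eqP; rewrite eq_le l2norm_ge0 andbT.
  by apply: le_trans (l2norm_mulmx _ _) _; rewrite mulr_le0_ge0 // l2norm_ge0.
by rewrite -colE !mxE.
Qed.

End operator_norm.

(** * Spectral projections and the gap estimate *)

Section projections.
Context (R : realType) (n : nat).
Implicit Types (u w x : 'cV[R[i]]_n) (a b E F P : 'M[R[i]]_n).

(** The condition that [is_projection] imposes at one point. *)
Definition orthoproj E : Prop := E *m E = E /\ E ^t* = E.

Lemma orthoproj_compl E : orthoproj E -> orthoproj (1%:M - E).
Proof.
move=> [EE Eh]; split.
  by rewrite mulmxBl !mulmxBr !mulmx1 !mul1mx EE subrr subr0.
apply/matrixP => i j; rewrite -{2}Eh !mxE rmorphB /=; congr (_ - _).
by rewrite rmorph_nat eq_sym.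
Qed.

Lemma orthoproj_mul_compl E : orthoproj E -> E *m (1%:M - E) = 0.
Proof. by move=> [EE _]; rewrite mulmxBr mulmx1 EE subrr. Qed.

Lemma orthoproj_pythagoras E u w : orthoproj E ->
  l2norm (E *m u + (1%:M - E) *m w) ^+ 2 =
  l2norm (E *m u) ^+ 2 + l2norm ((1%:M - E) *m w) ^+ 2.
Proof.
move=> pE; apply: l2norm_pythagoras; have [_ Eh] := pE.
rewrite trmx_mul map_mxM -mulmxA [_ *m (_ *m w)]mulmxA Eh.
by rewrite orthoproj_mul_compl // mul0mx mulmx0.
Qed.

Lemma orthoproj_split E x : orthoproj E ->
  l2norm x ^+ 2 = l2norm (E *m x) ^+ 2 + l2norm ((1%:M - E) *m x) ^+ 2.
Proof.
move=> pE; rewrite -orthoproj_pythagoras //.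
by rewrite mulmxBl mul1mx addrC subrK.
Qed.

Lemma l2norm_orthoproj E x : orthoproj E -> l2norm (E *m x) <= l2norm x.
Proof.
move=> pE; rewrite -ler_sqr ?nnegrE ?l2norm_ge0 //.
by rewrite (orthoproj_split x pE) lerDl sqr_ge0.
Qed.

Lemma opnorm_orthoproj E : orthoproj E -> opnorm E <= 1.
Proof.
by move=> pE; apply: opnorm_le => // v; rewrite mul1r l2norm_orthoproj.
Qed.

(** Davis-Kahan, one corner.  On the range of E the matrix a is bounded below
    by 1 - d, on the range of G = 1 - F the matrix b is bounded above by d, and
    a (E G) = E (a - b) G + (E G) (b G); comparing norms gives
    (1 - d) |E G| <= |a - b| + d |E G|. *)
Lemma orthoproj_half_gap a b E F d : orthoproj E -> orthoproj F ->
  a *m E = E *m a -> b *m F = F *m b ->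
  opnorm (a - E) <= d -> opnorm (b - F) <= d -> d < 1 / 2 ->
  (1 - 2 * d) * opnorm (E *m (1%:M - F)) <= opnorm (a - b).
Proof.
move=> pE pF aE bF aEd bFd d2; have [EE _] := pE.
have [] := orthoproj_compl pF; set G := 1%:M - F => GG _.
have FG : F *m G = 0 by exact: orthoproj_mul_compl.
have bG : b *m G = G *m b by rewrite mulmxBl mulmxBr bF mulmx1 mul1mx.
set m := opnorm (E *m G).
have m0 : 0 <= m by exact: opnorm_ge0.
have c0 : 0 < 1 - d by move: d2; clear; lra.
have d0 : 0 <= d by apply: le_trans aEd; exact: opnorm_ge0.
suff : m * (1 - d) <= opnorm (a - b) + m * d.
  by move: (opnorm (a - b)) m {m0}; clear => o m h; lra.
rewrite -ler_pdivlMr //.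
apply: opnorm_le.
  by apply: divr_ge0 (ltW c0); rewrite addr_ge0 ?mulr_ge0 ?opnorm_ge0.
move=> x; rewrite mulrAC ler_pdivlMr //.
set y := E *m G *m x.
have Gx : l2norm (G *m x) <= l2norm x.
  by apply: l2norm_orthoproj; exact: orthoproj_compl.
have ay : (1 - d) * l2norm y <= l2norm (a *m y).
  have yE : y = a *m y - (a - E) *m y.
    by rewrite mulmxBl opprB addrC subrK /y !mulmxA EE.
  have : l2norm y <= l2norm (a *m y) + d * l2norm y.
    rewrite {1}yE; apply: le_trans (l2normB _ _) _; rewrite lerD2l.
    apply: le_trans (l2norm_mulmx _ _) _.
    exact: ler_wpM2r (l2norm_ge0 _) _ _ aEd.
  by move: (l2norm y) (l2norm _); clear => ? ?; lra.
(* On the range of G the matrices b and b - F agree. *)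
have ayE : a *m y = E *m ((a - b) *m (G *m x))
                  + (E *m G) *m ((b - F) *m (G *m x)).
  have -> : (E *m G) *m ((b - F) *m (G *m x)) = E *m (b *m (G *m x)).
    rewrite mulmxBl (mulmxA F) FG mul0mx subr0 (mulmxA b) bG.
    by rewrite !mulmxA -(mulmxA E G G) GG.
  by rewrite mulmxBl mulmxBr subrK /y !mulmxA aE.
have : l2norm (a *m y) <= (opnorm (a - b) + m * d) * l2norm x.
  rewrite ayE mulrDl; apply: le_trans (l2normD _ _) _; apply: lerD.
    apply: le_trans (l2norm_orthoproj _ pE) _.
    apply: le_trans (l2norm_mulmx _ _) _.
    exact: ler_wpM2l (opnorm_ge0 _) _ _ Gx.
  apply: le_trans (l2norm_mulmx _ _) _.
  rewrite -mulrA; apply: ler_wpM2l m0 _ _ _.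
  apply: le_trans (l2norm_mulmx _ _) _.
  exact: ler_pM (opnorm_ge0 _) (l2norm_ge0 _) bFd Gx.
rewrite mulrC in ay; exact: le_trans.
Qed.

(** Davis-Kahan estimate.  E - F = E (1 - F) - (1 - E) F has orthogonal ranges
    and orthogonal supports, so its norm is that of its larger corner, and the
    second corner is the first one for the complementary data 1 - a, 1 - E,
    1 - b, 1 - F. *)
Lemma orthoproj_gap a b E F d : orthoproj E -> orthoproj F ->
  a *m E = E *m a -> b *m F = F *m b ->
  opnorm (a - E) <= d -> opnorm (b - F) <= d -> d < 1 / 2 ->
  (1 - 2 * d) * opnorm (E - F) <= opnorm (a - b).
Proof.
move=> pE pF aE bF aEd bFd d2.
have g0 : 0 < 1 - 2 * d by move: d2; clear; lra.
have m1 := orthoproj_half_gap pE pF aE bF aEd bFd d2.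
have cE := orthoproj_compl pE; have cF := orthoproj_compl pF.
have complB (c D : 'M[R[i]]_n) : (1%:M - c) - (1%:M - D) = - (c - D).
  by rewrite opprB addrC opprB addrA subrK addrC.
have complK (D : 'M[R[i]]_n) : 1%:M - (1%:M - D) = D.
  by rewrite opprB addrC subrK.
have comm (c D : 'M[R[i]]_n) : c *m D = D *m c ->
    (1%:M - c) *m (1%:M - D) = (1%:M - D) *m (1%:M - c).
  move=> cD; rewrite !mulmxBl !mulmxBr cD !mulmx1 !mul1mx !opprB.
  by rewrite addrACA [RHS]addrACA [- c + _]addrC.
have m2 : (1 - 2 * d) * opnorm ((1%:M - E) *m F) <= opnorm (a - b).
  have := @orthoproj_half_gap (1%:M - a) (1%:M - b) _ _ d cE cF
    (comm _ _ aE) (comm _ _ bF).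
  by rewrite !complB !complK !opnormN; apply.
rewrite mulrC -(ler_pdivlMr _ _ g0); set m := _ / _.
have m0 : 0 <= m by exact: divr_ge0 (opnorm_ge0 _) (ltW g0).
apply: (opnorm_le m0) => x.
have -> : (E - F) *m x = E *m ((1%:M - F) *m x) + (1%:M - E) *m (- (F *m x)).
  rewrite mulmxN !mulmxBl !mul1mx mulmxBr opprB.
  by rewrite addrA subrK.
have mx0 y : 0 <= m * l2norm y by exact: mulr_ge0 m0 (l2norm_ge0 y).
rewrite -ler_sqr ?nnegrE ?l2norm_ge0 ?mx0 //.
have [FF _] := pF; have [GG _] := cF.
have hG : l2norm (E *m ((1%:M - F) *m x)) <= m * l2norm ((1%:M - F) *m x).
  have -> : E *m ((1%:M - F) *m x) = E *m (1%:M - F) *m ((1%:M - F) *m x).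
    by rewrite -mulmxA (mulmxA (1%:M - F)) GG.
  apply: le_trans (l2norm_mulmx _ _) _; apply: ler_wpM2r (l2norm_ge0 _) _ _ _.
  by rewrite (ler_pdivlMr _ _ g0) mulrC; exact: m1.
have hF : l2norm ((1%:M - E) *m (F *m x)) <= m * l2norm (F *m x).
  have -> : (1%:M - E) *m (F *m x) = (1%:M - E) *m F *m (F *m x).
    by rewrite -mulmxA (mulmxA F) FF.
  apply: le_trans (l2norm_mulmx _ _) _; apply: ler_wpM2r (l2norm_ge0 _) _ _ _.
  by rewrite (ler_pdivlMr _ _ g0) mulrC; exact: m2.
rewrite orthoproj_pythagoras // mulmxN l2normN exprMn (orthoproj_split x pF).
rewrite mulrDr [X in _ <= X]addrC -!exprMn.
have sq u w : l2norm u <= m * l2norm w -> l2norm u ^+ 2 <= (m * l2norm w) ^+ 2.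
  by apply: lerXn2r; [exact: l2norm_ge0 | exact: mx0].
exact: lerD (sq _ _ hG) (sq _ _ hF).
Qed.

(** If v is a unit eigenvector of a for the eigenvalue l, then
    |(a - P) v|^2 = |1 - l|^2 |P v|^2 + |l|^2 |(1 - P) v|^2 is a mean of
    |1 - l|^2 and |l|^2; hence l is within d of 1 or of 0.  Moving each
    eigenvalue to an endpoint within d turns a into the projection E. *)
Lemma spectral_projection_exists a P d : a \is normalmx -> orthoproj P ->
  opnorm (a - P) <= d ->
  exists E, [/\ orthoproj E, a *m E = E *m a & opnorm (a - E) <= d].
Proof.
move=> /orthomx_spectralP aU pP aPd.
have {aU} [U [V [l [uU Vh VU aU]]]] : exists U V (l : 'rV[R[i]]_n),
    [/\ U \is unitarymx, V = U ^t*, V *m U = 1%:M & a = V *m diag_mx l *m U].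
  exists (spectralmx a), (invmx (spectralmx a)), (spectral_diag a).
  have uU := spectral_unitarymx a; split => //; first exact: invmx_unitary.
    by rewrite mulVmx // unitarymx_unit.
have d0 : 0 <= d := le_trans (opnorm_ge0 _) aPd.
have UV : U *m V = 1%:M by rewrite Vh; exact/unitarymxP.
pose e : 'rV[R[i]]_n :=
  \row_j (if ComplexField.Normc.normc (1 - l 0 j) <= d then 1 else 0).
have diagP j : ComplexField.Normc.normc (l 0 j - e 0 j) <= d.
  rewrite mxE; case: ifPn => [|h]; first by rewrite -normcN opprB.
  rewrite subr0 leNgt; apply/negP => h'; rewrite -ltNge in h.
  pose v := V *m delta_mx j (0 : 'I_1).
  have av : a *m v = l 0 j *: v.
    rewrite aU /v !mulmxA -(mulmxA _ U) UV mulmx1 -mulmxA mul_diag_mx.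
    rewrite scalemxAr; congr (_ *m _).
    apply/colP => k; rewrite !mxE.
    by case: eqP => [->|]; rewrite ?mulr0.
  have v1 : l2norm v = 1.
    by rewrite -(l2norm_unitary v uU) /v mulmxA UV mul1mx l2norm_delta.
  have := l2norm_mulmx (a - P) v; rewrite v1 mulr1 => /le_trans/(_ aPd).
  apply/negP; rewrite -ltNge.
  have avP : (a - P) *m v =
      P *m (- (1 - l 0 j) *: v) + (1%:M - P) *m (l 0 j *: v).
    rewrite mulmxBl av mulmxBl mul1mx -!scalemxAr scaleNr scalerBl scale1r.
    by rewrite opprB [RHS]addrC addrA subrK.
  rewrite -ltr_sqr ?nnegrE ?l2norm_ge0 // avP orthoproj_pythagoras //.
  rewrite -!scalemxAr !l2normZ normcN !exprMn.
  have := orthoproj_split v pP; rewrite v1 expr1n.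
  have sq (x y : R) : 0 <= x -> x < y -> x ^+ 2 < y ^+ 2 by clear => *; nra.
  have := sq _ _ d0 h; have := sq _ _ d0 h'.
  have := sqr_ge0 (l2norm (P *m v)); have := sqr_ge0 (l2norm ((1%:M - P) *m v)).
  set A := l2norm (P *m v) ^+ 2; set B := l2norm ((1%:M - P) *m v) ^+ 2.
  set X := ComplexField.Normc.normc (1 - l 0 j) ^+ 2.
  set Y := ComplexField.Normc.normc (l 0 j) ^+ 2.
  move: A B X Y (d ^+ 2); clear => A B X Y D B0 A0 DY DX AB.
  have {}AB : B = 1 - A by rewrite AB addrC addKr.
  rewrite {}AB in B0 *; have [A1|A1] := ltP 0 A; first by nra.
  have -> : A = 0 by apply/eqP; rewrite eq_le A0 A1.
  by rewrite mulr0 add0r subr0 mulr1.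
have Ud M N : V *m M *m U *m (V *m N *m U) = V *m (M *m N) *m U.
  by rewrite !mulmxA -(mulmxA _ U) UV mulmx1.
exists (V *m diag_mx e *m U); split.
- split.
    rewrite Ud; apply: (congr1 (fun D => V *m D *m U)); rewrite mulmx_diag.
    apply: congr1; apply/rowP => j; rewrite !mxE.
    by case: ifP; rewrite ?mulr1 ?mulr0.
  rewrite trmx_mul map_mxM trmx_mul map_mxM -Vh {2}Vh trmxCK mulmxA.
  apply: (congr1 (fun D => V *m D *m U)); rewrite tr_diag_mx map_diag_mx.
  apply: congr1; apply/rowP => j; rewrite !mxE.
  by case: ifP; rewrite ?rmorph1 ?rmorph0.
- rewrite {}aU !Ud; apply: (congr1 (fun D => V *m D *m U)).
  exact: diag_mxC.
- have -> : a - V *m diag_mx e *m U = V *m diag_mx (l - e) *m U.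
    have -> : diag_mx (l - e) = diag_mx l - diag_mx e.
      by apply/matrixP => i j; rewrite !mxE mulrnBl.
    by rewrite mulmxBr mulmxBl {1}aU.
  apply: (opnorm_le d0) => x; rewrite -!mulmxA.
  rewrite -(l2norm_unitary (V *m _) uU) (mulmxA U V) UV mul1mx.
  rewrite -(l2norm_unitary x uU); move: (U *m x) => z.
  rewrite -ler_sqr ?nnegrE ?mulr_ge0 ?l2norm_ge0 // exprMn !sqr_l2norm.
  rewrite mulr_sumr; apply: ler_sum => k _; rewrite mul_diag_mx !mxE.
  rewrite ComplexField.Normc.normcM exprMn ler_wpM2r ?sqr_ge0 //.
  rewrite ler_sqr ?nnegrE ?normc_ge0 //; have := diagP k.
  by rewrite mxE.
Qed.

(** A real combination of projections is self-adjoint. *)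
Lemma orthoproj_normal_comb (t : R) E F : orthoproj E -> orthoproj F ->
  (1 - t)%:C *: E + t%:C *: F \is normalmx.
Proof.
move=> [_ Eh] [_ Fh]; apply/normalmxP.
have -> : ((1 - t)%:C *: E + t%:C *: F) ^t* = (1 - t)%:C *: E + t%:C *: F.
  apply/matrixP => i j; rewrite !mxE rmorphD !rmorphM /=.
  congr (_ * _ + _ * _).
  - by apply/eqP; rewrite eq_complex /= oppr0 !eqxx.
  - by rewrite -[in RHS]Eh !mxE.
  - by apply/eqP; rewrite eq_complex /= oppr0 !eqxx.
  - by rewrite -[in RHS]Fh !mxE.
by [].
Qed.

End projections.

(** * Paths of Lipschitz projections *)

Section projection_paths.
Context (R : realType) (n : nat) (W : metricType R).
Implicit Types (P Q h : W -> 'M[R[i]]_n) (t u : R).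

Definition is_lipschitz (K : R) (a : W -> 'M[R[i]]_n) : Prop :=
  forall z w, opnorm (a z - a w) <= K * mdist z w.

(** Being Lipschitz in t, uniformly over the space, instead of only continuous,
    passes to concatenated paths by adding the constants, and the paths of
    spectral projections have this property. *)
Definition joinable (K : R) P Q : Prop :=
  exists p : R -> W -> 'M[R[i]]_n,
    [/\ forall t, 0 <= t <= 1 -> is_projection (p t) /\ is_lipschitz K (p t),
        exists2 C, 0 <= C & forall t u, 0 <= t <= 1 -> 0 <= u <= 1 ->
          forall z, opnorm (p t z - p u z) <= C * `|t - u|,
        p 0 = P & p 1 = Q].

Lemma joinable_sym K P Q : joinable K P Q -> joinable K Q P.
Proof.
move=> [p [pK [C C0 pC] p0 p1]]; exists (fun t => p (1 - t)).
have flip t : 0 <= t <= 1 -> 0 <= 1 - t <= 1 by clear => ?; lra.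
split.
- by move=> t /flip; exact: pK.
- exists C => [//|t u /flip t01 /flip u01 z].
  apply: le_trans (pC _ _ t01 u01 z) _.
  by rewrite opprB addrC addrA subrK distrC.
- by rewrite subr0.
- by rewrite subrr.
Qed.

(** The concatenation is written as the sum of the two paths, each stopped at
    the common end Q outside its half of the interval, minus Q: its modulus
    then needs no case distinction between the two halves. *)
Lemma joinable_trans K P Q S : joinable K P Q -> joinable K Q S ->
  joinable K P S.
Proof.
move=> [p [pK [C C0 pC] p0 p1]] [q [qK [D D0 qD] q0 q1]].
pose f t : R := Num.min 1 (2 * t).
pose g t : R := Num.max 0 (2 * t - 1).
have f01 t : 0 <= t <= 1 -> 0 <= f t <= 1.
  rewrite /f => /andP[? ?]; case: (leP 1 (2 * t)) => ?.
    by apply/andP; split; lra.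
  by apply/andP; split; lra.
have g01 t : 0 <= t <= 1 -> 0 <= g t <= 1.
  rewrite /g => /andP[? ?]; case: (leP 0 (2 * t - 1)) => ?.
    by apply/andP; split; lra.
  by apply/andP; split; lra.
have bnd t u : t - u <= `|t - u| /\ - `|t - u| <= t - u.
  by split; [exact: ler_norm | exact: lerNnormlW].
have fL t u : `|f t - f u| <= 2 * `|t - u|.
  rewrite ler_norml /f; have := bnd t u; move: `|t - u|; clear => m [b1 b2].
  by case: (leP 1 (2 * t)) => ?; case: (leP 1 (2 * u)) => ?; apply/andP; split;
    lra.
have gL t u : `|g t - g u| <= 2 * `|t - u|.
  rewrite ler_norml /g; have := bnd t u; move: `|t - u|; clear => m [b1 b2].
  by case: (leP 0 (2 * t - 1)) => ?; case: (leP 0 (2 * u - 1)) => ?;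
    apply/andP; split; lra.
pose r t z := p (f t) z + q (g t) z - Q z.
have rL t : t <= 1 / 2 -> r t = p (2 * t).
  move=> t2; apply: funext => z; rewrite /r.
  have -> : f t = 2 * t by apply/min_idPr; lra.
  have -> : g t = 0 by apply/max_idPl; lra.
  by rewrite q0 addrK.
have rR t : 1 / 2 <= t -> r t = q (2 * t - 1).
  move=> t2; apply: funext => z; rewrite /r.
  have -> : f t = 1 by apply/min_idPl; lra.
  have -> : g t = 2 * t - 1 by apply/max_idPr; lra.
  by rewrite p1 addrAC subrr add0r.
exists r; split.
- move=> t /andP[t0 t1]; have [t2|/ltW t2] := leP t (1 / 2).
    by rewrite rL //; apply: pK; apply/andP; split; lra.
  by rewrite rR //; apply: qK; apply/andP; split; lra.
- exists (2 * (C + D)) => [|t u t01 u01 z]; first by rewrite mulr_ge0 ?addr_ge0.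
  have -> : r t z - r u z = (p (f t) z - p (f u) z) + (q (g t) z - q (g u) z).
    by rewrite /r opprB addrA subrK opprD addrACA.
  have := pC _ _ (f01 _ t01) (f01 _ u01) z.
  have := qD _ _ (g01 _ t01) (g01 _ u01) z.
  have := ler_wpM2l C0 (fL t u); have := ler_wpM2l D0 (gL t u).
  move: (opnormD (p (f t) z - p (f u) z) (q (g t) z - q (g u) z)).
  move: (opnorm _) (opnorm _) (opnorm _); clear => o1 o2 o3; lra.
- by rewrite rL ?mulr0 //; lra.
- rewrite rR; last by lra.
  by rewrite mulr1 (_ : 2 - 1 = 1 :> R) //; lra.
Qed.

(** The path consists of the spectral projections of the segment from P to Q;
    all its properties are instances of [orthoproj_gap], with d / 2 for the
    distance to the projections and hence 1 - d for the gap. *)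
Lemma joinable_close s d P Q : is_projection P -> is_projection Q ->
  is_lipschitz s P -> is_lipschitz s Q ->
  (forall z, opnorm (P z - Q z) <= d) -> d < 1 -> joinable ((1 - d)^-1 * s) P Q.
Proof.
move=> pP pQ sP sQ PQ d1.
pose a t z : 'M[R[i]]_n := (1 - t)%:C *: P z + t%:C *: Q z.
have aP t z : a t z - P z = t%:C *: (Q z - P z).
  rewrite /a rmorphB rmorph1 scalerBl scale1r scalerBr addrAC.
  by rewrite [P z - _ - _]addrAC subrr sub0r addrC.
have aQ t z : a t z - Q z = (1 - t)%:C *: (P z - Q z).
  rewrite /a rmorphB rmorph1 !scalerBl !scalerBr !scale1r opprB.
  by rewrite -addrA addrACA [RHS]addrACA [- Q z + _]addrC.
pose good t z E := [/\ orthoproj E, a t z *m E = E *m a t z &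
  opnorm (a t z - E) <= d / 2].
have ex t z : 0 <= t <= 1 -> exists E, good t z E.
  move=> /andP[t0 t1].
  have na : a t z \is normalmx by exact: orthoproj_normal_comb (pP z) (pQ z).
  have PQz := PQ z; have := opnorm_ge0 (P z - Q z) => PQ0.
  have [t2|t2] := leP t (1 / 2).
    apply: spectral_projection_exists na (pP z) _.
    rewrite aP; apply: le_trans (opnormZ _ _) _; rewrite ger0_norm // opnormB.
    by move: (opnorm _) PQ0 PQz => o; clear -t0 t1 t2; nra.
  apply: spectral_projection_exists na (pQ z) _.
  rewrite aQ; apply: le_trans (opnormZ _ _) _; rewrite ger0_norm ?subr_ge0 //.
  by move: (opnorm _) PQ0 PQz => o; clear -t0 t1 t2; nra.
(* The choice is harmless, as the gap estimate shows that there is only one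
   good projection. *)
pose p t z := xget (P z) [set E | good t z E].
have pg t z : 0 <= t <= 1 -> good t z (p t z).
  by move=> /ex -/(_ z) [E gE]; rewrite /p; exact: (xgetI _ gE).
have gap t z u w E F : good t z E -> good u w F ->
    opnorm (E - F) <= (1 - d)^-1 * opnorm (a t z - a u w).
  move=> [pE aE Ed] [pF bF Fd]; rewrite mulrC ler_pdivlMr ?subr_gt0 // mulrC.
  have := orthoproj_gap pE pF aE bF Ed Fd.
  have -> : 2 * (d / 2) = d by rewrite mulrC divfK.
  by apply; move: d1; clear; lra.
have c0 : 0 <= (1 - d)^-1 by rewrite invr_ge0 subr_ge0 ltW.
have g0 z : good 0 z (P z).
  have a0 : a 0 z = P z by rewrite /a subr0 scale1r scale0r addr0.
  rewrite /good a0; split; [exact: pP | by [] |].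
  by rewrite subrr opnorm0 divr_ge0 // (le_trans (opnorm_ge0 _) (PQ z)).
have g1 z : good 1 z (Q z).
  have a1 : a 1 z = Q z by rewrite /a subrr scale1r scale0r add0r.
  rewrite /good a1; split; [exact: pQ | by [] |].
  by rewrite subrr opnorm0 divr_ge0 // (le_trans (opnorm_ge0 _) (PQ z)).
have guniq t z E F : good t z E -> good t z F -> E = F.
  move=> gE gF; apply/eqP; rewrite -subr_eq0; apply/eqP; apply: opnorm_le0_eq0.
  by have := gap _ _ _ _ _ _ gE gF; rewrite subrr opnorm0 mulr0.
have i0 : 0 <= (0 : R) <= 1 by rewrite lexx ler01.
have i1 : 0 <= (1 : R) <= 1 by rewrite lexx ler01.
exists p; split.
- move=> t t01; split=> [z|z w]; first by have [] := pg t z t01.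
  apply: le_trans (gap _ _ _ _ _ _ (pg t z t01) (pg t w t01)) _.
  rewrite -mulrA; apply: (ler_wpM2l c0).
  have -> : a t z - a t w = (1 - t)%:C *: (P z - P w) + t%:C *: (Q z - Q w).
    by rewrite /a !scalerBr opprD addrACA.
  apply: le_trans (opnormD _ _) _.
  have := sP z w; have := sQ z w; have := opnormZ (1 - t) (P z - P w).
  have := opnormZ t (Q z - Q w); have /andP[t0 t1] := t01.
  rewrite !ger0_norm ?subr_ge0 //.
  move: (opnorm _) (opnorm _) (opnorm _) (opnorm _) (mdist _ _).
  by clear -t0 t1 => o1 o2 o3 o4 m; nra.
- exists ((1 - d)^-1 * `|d|) => [|t u t01 u01 z]; first by rewrite mulr_ge0.
  apply: le_trans (gap _ _ _ _ _ _ (pg t z t01) (pg u z u01)) _.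
  rewrite -mulrA; apply: (ler_wpM2l c0).
  have -> : a t z - a u z = (t - u)%:C *: (Q z - P z).
    have -> : a t z - a u z = (a t z - P z) - (a u z - P z).
      by rewrite opprB addrA subrK.
    by rewrite !aP -scalerBl -rmorphB.
  apply: le_trans (opnormZ _ _) _; rewrite mulrC; apply: ler_wpM2r => //.
  by rewrite opnormB; apply: le_trans (PQ z) _; exact: ler_norm.
- by apply: funext => z; exact: guniq (pg 0 z i0) (g0 z).
- by apply: funext => z; exact: guniq (pg 1 z i1) (g1 z).
Qed.

(** Compactness of the unit interval: the supremum c of the points related to 0
    is related to one of them by the local hypothesis at c, and c < 1 would let
    the same hypothesis reach beyond c. *)
Lemma unit_interval_chain (J : R -> R -> Prop) :
  (forall t u, J t u -> J u t) ->
  (forall t u v, J t u -> J u v -> J t v) ->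
  (forall t, 0 <= t <= 1 -> exists2 k, 0 < k &
     forall u, 0 <= u <= 1 -> `|u - t| < k -> J t u) ->
  J 0 1.
Proof.
move=> Jsym Jtr Jloc.
pose A := [set t | 0 <= t <= 1 /\ J 0 t].
have J00 : J 0 0.
  have [|k k0 Jk] := Jloc 0; first by rewrite lexx ler01.
  by apply: Jk; rewrite ?lexx ?ler01 // subrr normr0.
have A0 : A 0 by split; rewrite ?lexx ?ler01.
have supA : has_sup A.
  by split; [exists 0 | exists 1 => t [/andP[]]].
pose c := sup A.
have c0 : 0 <= c by exact: (ub_le_sup supA.2 A0).
have c1 : c <= 1 by apply: (ge_sup supA.1) => t [/andP[]].
have c01 : 0 <= c <= 1 by rewrite c0 c1.
have [k k0 Jk] := Jloc c c01.
have [t At ct] := sup_adherent k0 supA.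
have tc : t <= c by exact: (ub_le_sup supA.2 At).
have [t01 J0t] := At.
have J0c : J 0 c.
  apply: (Jtr _ _ _ J0t); apply: Jsym; apply: (Jk _ t01).
  by rewrite ler0_norm ?subr_le0 //; move: ct; rewrite /c; lra.
have [cl|] := ltP c 1; last first.
  by move=> lc; rewrite (_ : 1 = c :> R) //; apply/eqP; rewrite eq_le lc c1.
pose u := Num.min 1 (c + k / 2).
have cu : c < u by rewrite lt_min cl ltrDl divr_gt0.
have u1 : u <= 1 by rewrite ge_min lexx.
have Au : A u.
  have u01 : 0 <= u <= 1 by rewrite u1 (le_trans c0 (ltW cu)).
  split=> //; apply: (Jtr _ _ _ J0c); apply: (Jk _ u01).
  have : u <= c + k / 2 by rewrite ge_min lexx orbT.
  by rewrite gtr0_norm ?subr_gt0 //; lra.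
by have := ub_le_sup supA.2 Au; rewrite leNgt cu.
Qed.

(** Continuity in t is required on the net A alone.  Elsewhere the Lipschitz
    bounds transport it at the cost 2 eps s, which leaves members of the family
    at nearby times within d < 1 of each other. *)
Lemma family_joinable (A : set W) (eps s d : R) (h : R -> W -> 'M[R[i]]_n) :
  0 <= s -> 2 * eps * s < d -> d < 1 ->
  (forall z, exists2 a, A a & mdist z a <= eps) ->
  (forall t, 0 <= t <= 1 -> is_projection (h t) /\ is_lipschitz s (h t)) ->
  (forall t, 0 <= t <= 1 -> forall e, 0 < e -> exists2 k, 0 < k &
     forall u, 0 <= u <= 1 -> `|u - t| < k ->
     forall a, A a -> opnorm (h u a - h t a) <= e) ->
  joinable ((1 - d)^-1 * s) (h 0) (h 1).
Proof.
move=> s0 sd d1 dense hP hc.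
apply: (@unit_interval_chain (fun t u => joinable _ (h t) (h u))).
- by move=> t u; exact: joinable_sym.
- by move=> t u v; exact: joinable_trans.
move=> t t01; have [|k k0 hk] := hc t t01 (d - 2 * eps * s).
  by rewrite subr_gt0.
exists k => // u u01 ut.
have [pt lt] := hP t t01; have [pu lu] := hP u u01.
apply: joinable_close => // z; have [x Ax zx] := dense z.
have := hk u u01 ut x Ax; have := lt z x; have := lu x z.
have := opnorm_dist (h t z) (h t x) (h u z).
have := opnorm_dist (h t x) (h u x) (h u z).
rewrite (opnormB (h u x) (h t x)) (metric_sym x z).
have := ler_wpM2l s0 zx.
move: (opnorm _) (opnorm _) (opnorm _) (opnorm _) (opnorm _) (mdist _ _).
by clear => *; lra.
Qed.

End projection_paths.

(** * Lipschitz seminorm and path continuity *)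

Section lipschitz_seminorm.
Context (R : realType) (n : nat) (W : metricType R).
Implicit Types (a b : W -> 'M[R[i]]_n) (K : R).

Lemma lipL_leP a K : 0 <= K -> (lipL a <= K%:E)%E <-> is_lipschitz K a.
Proof.
move=> K0; split=> [aK z w|aK].
  have [->|zw] := eqVneq z w; first by rewrite subrr opnorm0 mdistxx mulr0.
  have m0 : 0 < mdist z w by rewrite mdist_gt0.
  rewrite -ler_pdivrMr // -lee_fin; apply: le_trans aK.
  rewrite /lipL le_max; apply/orP; right; apply: ereal_sup_ubound.
  by exists (z, w) => //=; apply/eqP.
rewrite /lipL ge_max lee_fin K0 /=.
apply: ge_ereal_sup => _ [[z w] /= /eqP zw <-].
by rewrite lee_fin ler_pdivrMr ?mdist_gt0 //; exact: aK.
Qed.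

Lemma lip_proj_ltP a K : 0 <= K -> lip_proj_lt n W K a ->
  is_projection a /\ is_lipschitz K a.
Proof. by move=> K0 [[_ pa _] /ltW aK]; split=> //; apply/lipL_leP. Qed.

Lemma lipschitz_lip_proj a K : 0 <= K -> is_projection a -> is_lipschitz K a ->
  lip_proj n W a.
Proof.
move=> K0 pa aK; split=> //.
  move=> w; apply/cvgrPdist_le => e e0.
  (* K itself may be 0. *)
  have k0 : 0 < e / (K + 1) by rewrite divr_gt0 // ltr_wpDl.
  have : nbhs w (ball w (e / (K + 1))) by exact: nbhsx_ballx.
  apply: filterS => v; rewrite ballEmdist /= => wv.
  rewrite sub0r normrN ger0_norm ?opnorm_ge0 //; apply: le_trans (aK v w) _.
  rewrite metric_sym; move: wv; rewrite ltr_pdivlMr ?ltr_wpDl // => wv.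
  have := mdist_ge0 w v; move: wv; move: (mdist w v).
  by clear => m; lra.
by apply: le_lt_trans (ltry K); apply/lipL_leP.
Qed.

Lemma mx_norm_sup_ge0 a : 0 <= mx_norm_sup a.
Proof.
rewrite /mx_norm_sup; set B := [set _ | _ in _].
have [[[b Bb] supB]|/sup_out -> //] := pselect (has_sup B).
apply: le_trans (ub_le_sup supB Bb); have [w _ <-] := Bb.
exact: opnorm_ge0.
Qed.

(** The sign condition on c matters over the empty space, where the supremum
    is 0. *)
Lemma mx_norm_sup_le a c : 0 <= c -> (forall w, opnorm (a w) <= c) ->
  mx_norm_sup a <= c.
Proof.
move=> c0 ac; rewrite /mx_norm_sup; set B := [set _ | _ in _].
have [->|B0] := eqVneq B set0; first by rewrite sup0.
by apply: ge_sup => [|_ [w _ <-]] //; exact/set0P.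
Qed.

Lemma opnorm_le_mx_norm_sup a c w : (forall v, opnorm (a v) <= c) ->
  opnorm (a w) <= mx_norm_sup a.
Proof.
move=> ac; apply: ub_le_sup; last by exists w.
by exists c => _ [v _ <-].
Qed.

Lemma is_path_lipschitz (S : set (W -> 'M[R[i]]_n))
    (p : R -> W -> 'M[R[i]]_n) C :
  0 <= C -> (forall t, 0 <= t <= 1 -> S (p t)) ->
  (forall t u, 0 <= t <= 1 -> 0 <= u <= 1 ->
     forall z, opnorm (p t z - p u z) <= C * `|t - u|) ->
  is_path S p (p 0) (p 1).
Proof.
move=> C0 pS pC; split=> // t; rewrite in_itv /= => t01.
apply/cvgrPdist_le => e e0.
(* C itself may be 0. *)
have k0 : 0 < e / (C + 1) by rewrite divr_gt0 // ltr_wpDl.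
rewrite /within /=.
have : nbhs t (ball t (e / (C + 1))) by exact: nbhsx_ballx.
apply: filterS => u /= tu; rewrite in_itv /= => u01.
rewrite sub0r normrN ger0_norm ?mx_norm_sup_ge0 //.
apply: mx_norm_sup_le (ltW e0) _ => w.
apply: le_trans (pC u t u01 t01 w) _.
rewrite distrC; move: tu; rewrite /ball /= ltr_pdivlMr ?ltr_wpDl // => tu.
by have := normr_ge0 (t - u); move: tu; move: `|_|; clear => m; lra.
Qed.

(** Values of a path of projections differ by at most 2 in norm, so that
    [mx_norm_sup] is a genuine supremum, and convergence in it is uniform
    convergence. *)
Lemma is_path_modulus (S : set (W -> 'M[R[i]]_n))
    (p : R -> W -> 'M[R[i]]_n) a b :
  S `<=` [set c | is_projection c] -> is_path S p a b ->
  forall t, 0 <= t <= 1 -> forall e, 0 < e -> exists2 k, 0 < k &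
    forall u, 0 <= u <= 1 -> `|u - t| < k ->
    forall w, opnorm (p u w - p t w) <= e.
Proof.
move=> Sp [pS pc _ _] t t01 e e0.
have It (u : R) : 0 <= u <= 1 -> u \in `[0, 1] by rewrite in_itv.
have := pc t (It t t01) => /cvgrPdist_le/(_ _ e0).
rewrite /within /= => /nbhs_ballP[k /= k0 kp]; exists k => // u u01 utk w.
have := kp u; rewrite /ball /= distrC => /(_ utk) /=.
rewrite in_itv /= => /(_ u01); rewrite sub0r normrN => /(le_trans (ler_norm _)).
apply: le_trans; apply: (@opnorm_le_mx_norm_sup (p u - p t) (1 + 1)) => v.
apply: le_trans (opnormD _ _) _; rewrite opnormN.
by apply: lerD; apply: opnorm_orthoproj; exact: (Sp _ (pS _ (It _ _))).
Qed.

Lemma path_component_projection (C : set (W -> 'M[R[i]]_n)) r :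
  is_path_component (lip_proj_lt n W r) C -> C `<=` [set c | is_projection c].
Proof.
move=> [a _ ->] b [g [gS _ _ <-]].
by have [|[]] := gS 1; rewrite ?in_itv /= ?ler01 ?lexx.
Qed.

End lipschitz_seminorm.

(** * Direct sums over a disjoint union *)

Lemma hausdorff_distC (R : realType) (Z : metricType R) (A B : set Z) :
  hausdorff_dist A B = hausdorff_dist B A.
Proof. by rewrite /hausdorff_dist maxC. Qed.

(** A point z of A serves as its own approximation: eps is not assumed
    nonnegative, but the point of B near z forces it. *)
Lemma hausdorff_dist_lt_net (R : realType) (Z : metricType R) (A B : set Z)
    (eps : R) :
  (hausdorff_dist A B < eps%:E)%E -> (forall z, A z \/ B z) ->
  forall z, exists2 a, A a & mdist z a <= eps.
Proof.
rewrite /hausdorff_dist gt_max => /andP[AB BA] cov z.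
have near (C D : set Z) : (ereal_sup [set dist_to D c | c in C] < eps%:E)%E ->
    C z -> exists2 d, D d & mdist z d < eps.
  move=> CD Cz; have : (dist_to D z < eps%:E)%E.
    by apply: le_lt_trans CD; apply: ereal_sup_ubound; exists z.
  by move=> /ereal_inf_lt[_ [d Dd <-]]; rewrite lte_fin => ?; exists d.
have [Az|Bz] := cov z.
  have [b _ zb] := near _ _ AB Az; exists z => //.
  by rewrite mdistxx (le_trans (mdist_ge0 z b) (ltW zb)).
by have [a Aa za] := near _ _ BA Bz; exists a => //; exact: ltW.
Qed.

Section direct_sum_paths.
Context (R : realType) (n : nat) (X Y : metricType R).
Context (rho : X + Y -> X + Y -> R) (hrho : is_metric rho).
Context (rhoX : forall x x' : X, rho (inl x) (inl x') = mdist x x').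
Context (rhoY : forall y y' : Y, rho (inr y) (inr y') = mdist y y').
Notation Z := (with_metric hrho).

Lemma oplus_restr (a : Z -> 'M[R[i]]_n) :
  oplus hrho (restrX hrho a) (restrY hrho a) = a.
Proof. by apply: funext => -[]. Qed.

Lemma oplus_projection (p : X -> 'M[R[i]]_n) (q : Y -> 'M[R[i]]_n) :
  is_projection p -> is_projection q -> is_projection (oplus hrho p q).
Proof. by move=> pp pq [x|y]; [exact: pp | exact: pq]. Qed.

Lemma joinable_oplus_paths (K K' : R) p0 p1 q0 q1 : 0 <= K -> K < K' ->
  joinable K (oplus hrho p0 q0) (oplus hrho p1 q1) ->
  exists (p : R -> X -> 'M[R[i]]_n) (q : R -> Y -> 'M[R[i]]_n),
    [/\ is_path (lip_proj n X) p p0 p1, is_path (lip_proj n Y) q q0 q1 &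
      forall t : R, t \in `[0, 1] ->
        (lipL (oplus hrho (p t) (q t)) < K'%:E)%E].
Proof.
move=> K0 KK' [a [aK [C C0 aC] a0 a1]].
exists (fun t => restrX hrho (a t)), (fun t => restrY hrho (a t)); split.
- have -> : p0 = restrX hrho (a 0) by rewrite a0.
  have -> : p1 = restrX hrho (a 1) by rewrite a1.
  apply: (@is_path_lipschitz R n X _ (fun t => restrX hrho (a t)) C) => //.
    move=> t /aK[pt lt]; apply: (lipschitz_lip_proj K0) => [x|x x'].
      exact: pt (inl x).
    by rewrite -rhoX; exact: lt (inl x) (inl x').
  by move=> t u t01 u01 x; exact: aC t u t01 u01 (inl x).
- have -> : q0 = restrY hrho (a 0) by rewrite a0.
  have -> : q1 = restrY hrho (a 1) by rewrite a1.
  apply: (@is_path_lipschitz R n Y _ (fun t => restrY hrho (a t)) C) => //.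
    move=> t /aK[pt lt]; apply: (lipschitz_lip_proj K0) => [x|x x'].
      exact: pt (inr x).
    by rewrite -rhoY; exact: lt (inr x) (inr x').
  by move=> t u t01 u01 x; exact: aC t u t01 u01 (inr x).
- move=> t; rewrite in_itv /= => /aK[_ lt]; rewrite oplus_restr.
  apply: (@le_lt_trans _ _ K%:E); last by rewrite lte_fin.
  exact/lipL_leP.
Qed.

(** The extensions f t of the given path are arbitrary away from A, so those at
    the two ends are replaced by the prescribed direct sums, with which they
    agree on A. *)
Lemma family_oplus_paths (A : set Z) (eps s delta : R)
    (f : R -> Z -> 'M[R[i]]_n) p0 p1 q0 q1 :
  0 < s -> 2 * eps * s < delta -> delta < 1 ->
  (forall z, exists2 a, A a & mdist z a <= eps) ->
  is_projection p0 -> is_projection p1 ->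
  is_projection q0 -> is_projection q1 ->
  (lipL (oplus hrho p0 q0) <= s%:E)%E -> (lipL (oplus hrho p1 q1) <= s%:E)%E ->
  (forall t, 0 <= t <= 1 -> lip_proj_lt n Z s (f t)) ->
  {in A, f 0 =1 oplus hrho p0 q0} -> {in A, f 1 =1 oplus hrho p1 q1} ->
  (forall t, 0 <= t <= 1 -> forall e, 0 < e -> exists2 k, 0 < k &
     forall u, 0 <= u <= 1 -> `|u - t| < k ->
     forall a, A a -> opnorm (f u a - f t a) <= e) ->
  exists (p : R -> X -> 'M[R[i]]_n) (q : R -> Y -> 'M[R[i]]_n),
    [/\ is_path (lip_proj n X) p p0 p1, is_path (lip_proj n Y) q q0 q1 &
      forall t : R, t \in `[0, 1] ->
        (lipL (oplus hrho (p t) (q t)) < ((1 - delta)^-1 * s)%:E)%E].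
Proof.
move=> s0 sd d1 dense pp0 pp1 pq0 pq1 l0 l1 fs f0 f1 fc.
(* A constant below delta leaves room for the strict inequality. *)
pose d := (2 * eps * s + delta) / 2.
have sd' : 2 * eps * s < d by rewrite midf_lt.
have dd : d < delta by rewrite midf_lt.
have d1' : d < 1 := lt_trans dd d1.
have id0 : 0 < (1 - d)^-1 by rewrite invr_gt0 subr_gt0.
apply: (@joinable_oplus_paths ((1 - d)^-1 * s)).
- by rewrite mulr_ge0 ?ltW.
- by rewrite ltr_pM2r // ltf_pV2 ?posrE ?subr_gt0 // ltrD2l ltrN2.
pose h t := if t == 0 then oplus hrho p0 q0
            else if t == 1 then oplus hrho p1 q1 else f t.
have hA t a : A a -> h t a = f t a.
  move=> Aa; have aA : a \in A by rewrite inE.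
  rewrite /h; case: eqP => [->|_]; first by rewrite f0.
  by case: eqP => [->|//]; rewrite f1.
have -> : oplus hrho p0 q0 = h 0 by rewrite /h eqxx.
have -> : oplus hrho p1 q1 = h 1 by rewrite /h oner_eq0 eqxx.
apply: (family_joinable (ltW s0) sd' d1' dense).
- move=> t t01; rewrite /h; case: eqP => _.
    by split; [exact: oplus_projection | apply/lipL_leP => //; exact: ltW].
  case: eqP => _.
    by split; [exact: oplus_projection | apply/lipL_leP => //; exact: ltW].
  by apply: lip_proj_ltP (fs t t01); exact: ltW.
- move=> t t01 e e0; have [k k0 kf] := fc t t01 e e0.
  exists k => [//|u u01 ut a Aa].
  rewrite (hA u a Aa) (hA t a Aa).
  exact: kf u u01 ut a Aa.
Qed.

End direct_sum_paths.

Theorem theorem4p7 (R : realType) (X Y : metricType R)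
  (cX : compact [set: X]) (cY : compact [set: Y])
  (rho : X + Y -> X + Y -> R) (hrho : is_metric rho)
  (rhoX : forall x x' : X, rho (inl x) (inl x') = mdist x x')
  (rhoY : forall y y' : Y, rho (inr y) (inr y') = mdist y y')
  (eps : R) (hXY : (hausdorff_dist (partX hrho) (partY hrho) < eps%:E)%E)
  (n : nat) (n_gt0 : (0 < n)%N)
  (r : R) (r_gt0 : 0 < r) (eps_r : eps * r < 1 / 2)
  (s : R) (s_gt0 : 0 < s) (r_le_s : r <= s) (eps_s : eps * s < 1 / 2) :
  (forall (C : set (X -> 'M[R[i]]_n)) (p0 p1 : X -> 'M[R[i]]_n)
      (q0 q1 : Y -> 'M[R[i]]_n),
    is_path_component (lip_proj_lt n X r) C ->
    C p0 -> C p1 -> lip_proj_lt n Y s q0 -> lip_proj_lt n Y s q1 ->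
    (lipL (oplus hrho p0 q0) <= s%:E)%E ->
    (lipL (oplus hrho p1 q1) <= s%:E)%E ->
    (exists2 g : R -> X -> 'M[R[i]]_n, is_path C g p0 p1 &
       forall t : R, t \in `[0, 1] ->
         (restrX hrho @` lip_proj_lt n (with_metric hrho) s) (g t)) ->
    forall delta : R, 2 * eps * s < delta -> delta < 1 ->
    exists (p : R -> X -> 'M[R[i]]_n) (q : R -> Y -> 'M[R[i]]_n),
      [/\ is_path (lip_proj n X) p p0 p1, is_path (lip_proj n Y) q q0 q1 &
        forall t : R, t \in `[0, 1] ->
          (lipL (oplus hrho (p t) (q t)) < ((1 - delta)^-1 * s)%:E)%E])
  /\
  (forall (C : set (Y -> 'M[R[i]]_n)) (p0 p1 : X -> 'M[R[i]]_n)
      (q0 q1 : Y -> 'M[R[i]]_n),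
    is_path_component (lip_proj_lt n Y r) C ->
    C q0 -> C q1 -> lip_proj_lt n X s p0 -> lip_proj_lt n X s p1 ->
    (lipL (oplus hrho p0 q0) <= s%:E)%E ->
    (lipL (oplus hrho p1 q1) <= s%:E)%E ->
    (exists2 g : R -> Y -> 'M[R[i]]_n, is_path C g q0 q1 &
       forall t : R, t \in `[0, 1] ->
         (restrY hrho @` lip_proj_lt n (with_metric hrho) s) (g t)) ->
    forall delta : R, 2 * eps * s < delta -> delta < 1 ->
    exists (p : R -> X -> 'M[R[i]]_n) (q : R -> Y -> 'M[R[i]]_n),
      [/\ is_path (lip_proj n X) p p0 p1, is_path (lip_proj n Y) q q0 q1 &
        forall t : R, t \in `[0, 1] ->
          (lipL (oplus hrho (p t) (q t)) < ((1 - delta)^-1 * s)%:E)%E]).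
Proof.
have It (t : R) : 0 <= t <= 1 -> t \in `[0, 1] by rewrite in_itv.
have i0 : 0 <= (0 : R) <= 1 by rewrite lexx ler01.
have i1 : 0 <= (1 : R) <= 1 by rewrite lexx ler01.
have s_ge0 := ltW s_gt0.
split=> C p0 p1 q0 q1 hC.
- move=> C0 C1 Q0 Q1 l0 l1 [g pg gZ] delta sd d1.
  have Cp := path_component_projection hC.
  have /choice[f fP] : forall t, exists f,
      0 <= t <= 1 ->
      lip_proj_lt n (with_metric hrho) s f /\ restrX hrho f = g t.
    move=> t; have [t01|] := pselect (0 <= t <= 1); last by exists (fun=> 0).
    by have [f fs fg] := gZ t (It t t01); exists f.
  have fX t x : 0 <= t <= 1 -> f t (inl x) = g t x by move=> /fP[_ <-].
  have [_ _ g0 g1] := pg.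
  have net : forall z, exists2 a, partX hrho a & mdist z a <= eps.
    by apply: (hausdorff_dist_lt_net hXY) => -[x|y]; [left | right]; eexists.
  have [pQ0 _] := lip_proj_ltP s_ge0 Q0.
  have [pQ1 _] := lip_proj_ltP s_ge0 Q1.
  apply: (family_oplus_paths rhoX rhoY s_gt0 sd d1 net
    (Cp _ C0) (Cp _ C1) pQ0 pQ1 l0 l1 (f := f)).
  + by move=> t /fP[].
  + by move=> z; rewrite inE => -[x ->]; rewrite (fX 0 x i0) g0.
  + by move=> z; rewrite inE => -[x ->]; rewrite (fX 1 x i1) g1.
  + move=> t t01 e e0; have [k k0 kg] := is_path_modulus Cp pg t01 e0.
    exists k => [//|u u01 ut _ [x ->]]; rewrite (fX u x u01) (fX t x t01).
    exact: kg u u01 ut x.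
- move=> C0 C1 P0 P1 l0 l1 [g pg gZ] delta sd d1.
  have Cp := path_component_projection hC.
  have /choice[f fP] : forall t, exists f,
      0 <= t <= 1 ->
      lip_proj_lt n (with_metric hrho) s f /\ restrY hrho f = g t.
    move=> t; have [t01|] := pselect (0 <= t <= 1); last by exists (fun=> 0).
    by have [f fs fg] := gZ t (It t t01); exists f.
  have fY t y : 0 <= t <= 1 -> f t (inr y) = g t y by move=> /fP[_ <-].
  have [_ _ g0 g1] := pg.
  have net : forall z, exists2 a, partY hrho a & mdist z a <= eps.
    rewrite hausdorff_distC in hXY.
    by apply: (hausdorff_dist_lt_net hXY) => -[x|y]; [right | left]; eexists.
  have [pP0 _] := lip_proj_ltP s_ge0 P0.
  have [pP1 _] := lip_proj_ltP s_ge0 P1.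
  apply: (family_oplus_paths rhoX rhoY s_gt0 sd d1 net
    pP0 pP1 (Cp _ C0) (Cp _ C1) l0 l1 (f := f)).
  + by move=> t /fP[].
  + by move=> z; rewrite inE => -[y ->]; rewrite (fY 0 y i0) g0.
  + by move=> z; rewrite inE => -[y ->]; rewrite (fY 1 y i1) g1.
  + move=> t t01 e e0; have [k k0 kg] := is_path_modulus Cp pg t01 e0.
    exists k => [//|u u01 ut _ [y ->]]; rewrite (fY u y u01) (fY t y t01).
    exact: kg u u01 ut y.
Qed.
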